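(* There is an efficient (polynomial-time, given an independence oracle for $M$) combinatorial algorithm which, given an instance $((X,d),w,M,m)$ of Robust Matroid Center and a number $r\in\mathbb{R}_{\ge0}$, has the following guarantee: if there exists $F\in\mathcal{I}$ with $w(B(F,r))\ge m$, then the algorithm returns a set $R\in\mathcal{I}$ with $w(B(R,5r))\ge m$.
   Context: For a finite metric space $(X,d)$, $u\in X$ and $r\ge 0$, let $B(u,r)=\{v\in X: d(u,v)\le r\}$, and for $U\subseteq X$ let $B(U,r)=\bigcup_{u\in U}B(u,r)$. For $w\colon X\to\mathbb{R}_{\ge 0}$ and $U\subseteq X$, $w(U)=\sum_{u\in U}w(u)$. An instance of Robust Matroid Center consists of a finite metric space $(X,d)$, weights $w\colon X\to\mathbb{R}_{\ge0}$, a matroid $M=(X,\mathcal{I})$ given by an independence oracle, and $m\in\mathbb{R}_{\ge0}$; a solution of radius $r$ is a set $C\in\mathcal{I}$ with $w(B(C,r))\ge m$. *)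

(* Defs.v *)
From HB Require Import structures.
From mathcomp Require Import all_boot all_order all_algebra.
From mathcomp Require Import reals topology_structure uniform_structure.
From mathcomp Require Import pseudometric_structure metric_structure.

Set Implicit Arguments.
Unset Strict Implicit.
Unset Printing Implicit Defensive.

Import Order.TTheory GRing.Theory Num.Theory.
Local Open Scope ring_scope.

(* Here (X, d) is (X, mdist); the topology carried by metricType is determined
   by mdist and plays no role. *)
#[short(type="finMetricType")]
HB.structure Definition FinMetric (R : realType) :=
  {X of Finite X & Metric R X}.

Section Instances.
Variables (R : realType) (X : finMetricType R).

Definition fball (u : X) (r : R) : {set X} := [set v | mdist u v <= r].

Definition fballs (U : {set X}) (r : R) : {set X} :=
  \bigcup_(u in U) fball u r.

Definition total (w : X -> R) (U : {set X}) : R := \sum_(u in U) w u.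

Record is_matroid (I : {set {set X}}) : Prop := IsMatroid {
  matroid0 : set0 \in I;
  matroid_sub : forall J K : {set X}, J \subset K -> K \in I -> J \in I;
  matroid_aug : forall J K : {set X}, J \in I -> K \in I ->
    (#|J| < #|K|)%N -> exists2 x, x \in K :\: J & x |: J \in I
}.

Record rmc_instance := RmcInstance {
  weight : X -> R;
  weight_ge0 : forall x, 0 <= weight x;
  indep : {set {set X}};
  indep_matroid : is_matroid indep;
  target : R;
  target_ge0 : 0 <= target
}.

Definition rmc_solution (P : rmc_instance) (r : R) (C : {set X}) : Prop :=
  C \in indep P /\ target P <= total (weight P) (fballs C r).

End Instances.

(* The model of computation: a real random-access machine with an independence
   oracle, programmed in a while language.  The syntax depends neither on the
   reals nor on the input, so that one program serves all inputs.

   Memory consists of named arrays of natural numbers and named arrays of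
   reals, both indexed by natural numbers.  The points of the input space X are
   accessed only through their indices 0, ..., #|X| - 1, the distances, the
   weights, the radius and the target are read-only, and the matroid is
   accessed only through oracle queries.  There is no multiplication, rounding
   or conversion between reals and naturals: on rational inputs, a program of
   running time T computes numbers whose bit length is linear in T and in the
   bit length of the whole input, hence unit cost is a realistic measure. *)

Inductive nexp : Type :=
| NConst of nat
| NSize                    (* #|X| *)
| NGet of nat & nexp       (* NGet a e: cell number e of the array a *)
| NAdd of nexp & nexp
| NSub of nexp & nexp.     (* truncated *)

Inductive rexp : Type :=
| RZero
| RRadius
| RTarget
| RWeight of nexp
| RDist of nexp & nexp
| RGet of nat & nexp
| RAdd of rexp & rexp
| RSub of rexp & rexp.

Inductive bexp : Type :=
| BNle of nexp & nexp
| BRle of rexp & rexp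
| BIndep of nat            (* queries the set stored in an array of naturals *)
| BNot of bexp
| BAnd of bexp & bexp.

Inductive cmd : Type :=
| Skip
| NSet of nat & nexp & nexp   (* NSet a i e: cell number i of a becomes e *)
| RSet of nat & nexp & rexp
| Seq of cmd & cmd
| If of bexp & cmd & cmd
| While of bexp & cmd.

Record state (R : Type) := State {
  nmem : nat -> nat -> nat;
  rmem : nat -> nat -> R
}.

Definition upd (T : Type) (f : nat -> nat -> T) (a i : nat) (v : T) :
    nat -> nat -> T :=
  fun b j => if (b == a) && (j == i) then v else f b j.

Definition init_state (R : realType) : state R :=
  State (fun _ _ => 0%N) (fun _ _ => 0).

Section Semantics.
Variables (R : realType) (X : finMetricType R) (P : rmc_instance X) (r : R).
Implicit Types s : state R.

(* The point of index i, if i < #|X|; weights and distances read at an index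
   out of range are 0. *)
Definition point (i : nat) : option X := onth (enum X) i.

Definition weight_at (i : nat) : R :=
  if point i is Some x then weight P x else 0.

Definition dist_at (i j : nat) : R :=
  if (point i, point j) is (Some x, Some y) then mdist x y else 0.

(* The array a stores the set of the points whose cell is nonzero. *)
Definition stored_set s (a : nat) : {set X} :=
  [set x | nmem s a (index x (enum X)) != 0%N].

Fixpoint neval s (e : nexp) : nat :=
  match e with
  | NConst k => k
  | NSize => #|X|
  | NGet a e1 => nmem s a (neval s e1)
  | NAdd e1 e2 => (neval s e1 + neval s e2)%N
  | NSub e1 e2 => (neval s e1 - neval s e2)%N
  end.

Fixpoint reval s (e : rexp) : R :=
  match e with
  | RZero => 0
  | RRadius => r
  | RTarget => target P
  | RWeight e1 => weight_at (neval s e1)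
  | RDist e1 e2 => dist_at (neval s e1) (neval s e2)
  | RGet a e1 => rmem s a (neval s e1)
  | RAdd e1 e2 => reval s e1 + reval s e2
  | RSub e1 e2 => reval s e1 - reval s e2
  end.

Fixpoint beval s (b : bexp) : bool :=
  match b with
  | BNle e1 e2 => (neval s e1 <= neval s e2)%N
  | BRle e1 e2 => reval s e1 <= reval s e2
  | BIndep a => stored_set s a \in indep P
  | BNot b1 => ~~ beval s b1
  | BAnd b1 b2 => beval s b1 && beval s b2
  end.

(* exec c s t s': started in s, the program c halts in s' after t steps.  A
   step is an assignment, a Skip or a test of If or While; the expressions it
   evaluates, oracle queries included, have a size bounded by a constant of the
   program, so that counting their operations would change t by at most a
   constant factor. *)
Inductive exec : cmd -> state R -> nat -> state R -> Prop :=
| exec_skip s : exec Skip s 1 s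
| exec_nset s a i e :
    exec (NSet a i e) s 1
      (State (upd (nmem s) a (neval s i) (neval s e)) (rmem s))
| exec_rset s a i e :
    exec (RSet a i e) s 1
      (State (nmem s) (upd (rmem s) a (neval s i) (reval s e)))
| exec_seq c1 c2 s1 s2 s3 t1 t2 :
    exec c1 s1 t1 s2 -> exec c2 s2 t2 s3 ->
    exec (Seq c1 c2) s1 (t1 + t2) s3
| exec_if b c1 c2 s s' t :
    exec (if beval s b then c1 else c2) s t s' -> exec (If b c1 c2) s t.+1 s'
| exec_while_false b c s :
    ~~ beval s b -> exec (While b c) s 1 s
| exec_while_true b c s1 s2 s3 t1 t2 :
    beval s1 b -> exec c s1 t1 s2 -> exec (While b c) s2 t2 s3 ->
    exec (While b c) s1 (t1 + t2).+1 s3.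

Lemma exec_det c s t1 s1 t2 s2 :
  exec c s t1 s1 -> exec c s t2 s2 -> t1 = t2 /\ s1 = s2.
Proof.
move=> e1; elim: e1 t2 s2 => {c s t1 s1}.
- by move=> s t2 s2 e; inversion e.
- by move=> s a i e t2 s2 h; inversion h.
- by move=> s a i e t2 s2 h; inversion h.
- move=> c1 c2 s1 s2 s3 t1 t2 _ IH1 _ IH2 t s h.
  inversion h as [| | |? ? ? s' ? u1 u2 h1 h2| | |]; subst.
  by have [? ?] := IH1 _ _ h1; subst; have [? ?] := IH2 _ _ h2; subst.
- move=> b c1 c2 s s' t _ IH t2 s2 h.
  inversion h as [| | | |? ? ? ? ? u h1| |]; subst.
  by have [-> ->] := IH _ _ h1.
- move=> b c s nb t2 s2 h.
  inversion h as [| | | | | |? ? ? ? ? ? ? hb]; subst => //.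
  by rewrite hb in nb.
- move=> b c s1 s2 s3 t1 t2 hb _ IH1 _ IH2 t s h.
  inversion h as [| | | | |? ? ? nb|? ? ? s' ? u1 u2 _ h1 h2]; subst.
    by rewrite hb in nb.
  by have [? ?] := IH1 _ _ h1; subst; have [-> ->] := IH2 _ _ h2.
Qed.

(* The result of a run is the set stored in the array 0. *)
Definition output s : {set X} := stored_set s 0.

End Semantics.

(* Main.v *)
(** Centers are picked greedily: the next center u maximizes the uncovered
    weight of B(u,r) among the points for which the chosen centers, together
    with u, still have distinct representatives forming an independent set, the
    representative of c lying in B(c,2r); then B(u,3r) is declared covered.
    In the end the representatives are within 5r of every covered point.

    By Rado's theorem the sets of centers having such representatives form a
    matroid.  A solution F is exchanged step by step for the chosen centers,
    keeping the part F' of it that is still used: if u is within 2r of some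
    f in F', then B(u,3r) covers B(f,r), and f becomes the representative of u;
    otherwise B(u,r) is disjoint from B(F',r), some f leaves F' by matroid
    exchange, and the greedy choice pays for the loss of B(f,r).

    Whether u can be added is decided by augmenting paths.  Only the last step
    of a shortest path is performed, giving the last center a new
    representative; this shortens the distance from u to a center that can be
    given a free representative, so that at most #|X| such steps are needed. *)

Require Import Defs.
From mathcomp Require Import all_boot all_order all_algebra.
From mathcomp Require Import reals.
From mathcomp Require Import boolp metric_structure zify lra.

Set Implicit Arguments.
Unset Strict Implicit.
Unset Printing Implicit Defensive.

Import Order.TTheory GRing.Theory Num.Theory.
Local Open Scope ring_scope.

(** * For-programs and their semantics *)

Inductive prog : Type :=
| PSkip
| PN of nat & nexp & nexp
| PR of nat & nexp & rexp
| PSeq of prog & prog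
| PIf of bexp & prog & prog
| PFor of nat & prog.

Definition cell (v : nat) : nexp := NGet v (NConst 0).

Fixpoint compile (p : prog) : cmd :=
  match p with
  | PSkip => Skip
  | PN a i e => NSet a i e
  | PR a i e => RSet a i e
  | PSeq p1 p2 => Seq (compile p1) (compile p2)
  | PIf b p1 p2 => If b (compile p1) (compile p2)
  | PFor v p1 =>
      Seq (NSet v (NConst 0) (NConst 0))
        (While (BNle (NAdd (cell v) (NConst 1)) NSize)
           (Seq (compile p1)
              (NSet v (NConst 0) (NAdd (cell v) (NConst 1)))))
  end.

Fixpoint nwrites (p : prog) : seq nat :=
  match p with
  | PN a _ _ => [:: a]
  | PSeq p1 p2 | PIf _ p1 p2 => nwrites p1 ++ nwrites p2
  | PFor v p1 => v :: nwrites p1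
  | _ => [::]
  end.

Fixpoint rwrites (p : prog) : seq nat :=
  match p with
  | PR a _ _ => [:: a]
  | PSeq p1 p2 | PIf _ p1 p2 => rwrites p1 ++ rwrites p2
  | PFor _ p1 => rwrites p1
  | _ => [::]
  end.

Fixpoint wf (p : prog) : bool :=
  match p with
  | PSeq p1 p2 | PIf _ p1 p2 => wf p1 && wf p2
  | PFor v p1 => (v \notin nwrites p1) && wf p1
  | _ => true
  end.

Fixpoint cost (n : nat) (p : prog) : nat :=
  match p with
  | PSeq p1 p2 => cost n p1 + cost n p2
  | PIf _ p1 p2 => (cost n p1 + cost n p2).+1
  | PFor _ p1 => 2 + n * (cost n p1).+2
  | _ => 1
  end.

Lemma cost_poly (p : prog) :
  exists c k, forall n, (cost n p <= c * n.+1 ^ k)%N.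
Proof.
have add c1 k1 c2 k2 n : (c1 * n.+1 ^ k1 + c2 * n.+1 ^ k2 <=
    (c1 + c2) * n.+1 ^ (k1 + k2))%N.
  rewrite mulnDl leq_add // leq_mul2l leq_pexp2l ?orbT //.
    exact: leq_addr.
  exact: leq_addl.
have one c k n : (0 < c -> 0 < c * n.+1 ^ k)%N.
  by move=> c0; rewrite muln_gt0 c0 expn_gt0.
elim: p => [|a i e|a i e|p1 [c1 [k1 h1]] p2 [c2 [k2 h2]]
  |b p1 [c1 [k1 h1]] p2 [c2 [k2 h2]]|v p [c [k h]]].
1-3: by exists 1%N, 0%N => n; rewrite expn0.
- exists (c1 + c2)%N, (k1 + k2)%N => n /=.
  exact: leq_trans (leq_add (h1 n) (h2 n)) (add _ _ _ _ _).
- exists (c1 + c2).+1, (k1 + k2)%N => n /=.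
  rewrite -[(c1 + c2).+1]addn1 mulnDl -addn1 leq_add ?one //.
  exact: leq_trans (leq_add (h1 n) (h2 n)) (add _ _ _ _ _).
- exists (2 + (c + 2))%N, k.+1 => n /=.
  rewrite [leqRHS]mulnDl leq_add //; first by rewrite leq_pmulr ?expn_gt0.
  rewrite expnS mulnCA leq_mul // -addn2 mulnDl leq_add //.
  by rewrite leq_pmulr ?expn_gt0.
Qed.

Section Run.
Variables (R : realType) (X : finMetricType R) (P : rmc_instance X) (r : R).
Implicit Types (s : state R) (p : prog) (x : X).

Definition setn (a i v : nat) s : state R :=
  State (upd (nmem s) a i v) (rmem s).

Fixpoint run p s : state R :=
  match p with
  | PSkip => s
  | PN a i e => setn a (neval X s i) (neval X s e) s
  | PR a i e =>
      State (nmem s) (upd (rmem s) a (neval X s i) (reval P r s e))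
  | PSeq p1 p2 => run p2 (run p1 s)
  | PIf b p1 p2 => if beval P r s b then run p1 s else run p2 s
  | PFor v p1 =>
      setn v 0 #|X|
        (foldl (fun s i => run p1 (setn v 0 i s)) s (iota 0 #|X|))
  end.

Definition agree (nw rw : seq nat) s0 s : Prop :=
  (forall a, a \notin nw -> nmem s a = nmem s0 a) /\
  (forall a, a \notin rw -> rmem s a = rmem s0 a).

Lemma agree_refl nw rw s : agree nw rw s s.
Proof. by []. Qed.

Lemma agree_trans nw rw s1 s2 s3 :
  agree nw rw s1 s2 -> agree nw rw s2 s3 -> agree nw rw s1 s3.
Proof. by move=> [a b] [c d]; split=> i hi; rewrite ?c ?d ?a ?b. Qed.

Lemma agree_sub nw rw nw' rw' s s' :
  {subset nw <= nw'} -> {subset rw <= rw'} ->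
  agree nw rw s s' -> agree nw' rw' s s'.
Proof.
move=> sn sr [a b]; split=> i hi; first by apply: a; apply: contra hi => /sn.
by apply: b; apply: contra hi => /sr.
Qed.

Lemma setn_agree nw rw v i k s : v \in nw -> agree nw rw s (setn v i k s).
Proof.
move=> vn; split=> // a an /=; apply/funext => j; rewrite /upd.
by case: eqP => // av; rewrite av vn in an.
Qed.

Lemma run_agree p s : agree (nwrites p) (rwrites p) s (run p s).
Proof.
elim: p s => [|a i e|a i e|p1 h1 p2 h2|b p1 h1 p2 h2|v p h] s /=.
- exact: agree_refl.
- by apply: setn_agree; rewrite inE.
- split=> // b bn /=; apply/funext => j; rewrite /upd.
  by case: eqP => // ab; rewrite ab inE eqxx in bn.
- apply: (agree_trans (s2 := run p1 s)).
    by apply: agree_sub (h1 s) => a; rewrite mem_cat => ->.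
  by apply: agree_sub (h2 _) => a; rewrite mem_cat => ->; rewrite orbT.
- case: ifP => _.
    by apply: agree_sub (h1 s) => a; rewrite mem_cat => ->.
  by apply: agree_sub (h2 _) => a; rewrite mem_cat => ->; rewrite orbT.
- have vin : v \in v :: nwrites p by rewrite inE eqxx.
  apply: agree_trans (setn_agree _ _ _ _ vin).
  elim: (iota _ _) s => [|i l IH] s /=; first exact: agree_refl.
  apply: agree_trans (IH _).
  apply: agree_trans (setn_agree _ 0 i s vin) _.
  by apply: agree_sub (h _) => // a; rewrite inE => ->; rewrite orbT.
Qed.

Lemma setn_id a i v s : nmem s a i = v -> setn a i v s = s.
Proof.
case: s => f g /= fv; congr State; apply/funext => b; apply/funext => j.
by rewrite /= /upd; case: ifP => // /andP[/eqP-> /eqP->].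
Qed.

Lemma setnn a i v w s : setn a i v (setn a i w s) = setn a i v s.
Proof.
rewrite /setn; congr (State _ _); apply/funext => b; apply/funext => j.
by rewrite /= /upd; case: (_ && _).
Qed.

Lemma run_exec p s :
  wf p -> exists2 t, exec P r (compile p) s t (run p s) & (t <= cost #|X| p)%N.
Proof.
elim: p s => [|a i e|a i e|p1 h1 p2 h2|b p1 h1 p2 h2|v p h] s /=.
1-3: by exists 1%N => //; constructor.
- move=> /andP[/h1-/(_ s)[t1 e1 l1] /h2-/(_ (run p1 s))[t2 e2 l2]].
  by exists (t1 + t2)%N; [exact: exec_seq e1 e2|exact: leq_add].
- move=> /andP[w1 w2].
  have [t e l] : exists2 t, exec P r (if beval P r s b then compile p1
      else compile p2) s t (if beval P r s b then run p1 s else run p2 s) &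
      (t <= cost #|X| p1 + cost #|X| p2)%N.
    case: ifP => _.
      have [t e l] := h1 s w1; exists t => //.
      by apply: leq_trans l _; exact: leq_addr.
    have [t e l] := h2 s w2; exists t => //.
    by apply: leq_trans l _; exact: leq_addl.
  by exists t.+1 => //; apply: exec_if.
move=> /andP[vn w].
set W := While _ _.
have upd_v k s' : nmem (setn v 0 k s') v 0 = k by rewrite /= /upd !eqxx.
suff loop m i s' : (i + m = #|X|)%N -> nmem s' v 0 = i ->
    exists2 t, exec P r W s' t (setn v 0 #|X|
      (foldl (fun s i => run p (setn v 0 i s)) s' (iota i m))) &
      (t <= 1 + m * (cost #|X| p).+2)%N.
  have [t e l] := loop #|X| 0%N (setn v 0 0 s) (add0n _) (upd_v _ _).
  exists (1 + t)%N; last exact: l.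
  apply: exec_seq (exec_nset _ _ _ _ _ _) _ => /=.
  move: e; rewrite -/(setn v 0 0 s); case: (#|X|) => [|n] /=;
    by rewrite setnn.
elim: m i s' => [|m IH] i s'.
  rewrite addn0 => iX vi /=; exists 1%N => //.
  rewrite setn_id -?iX //.
  by apply: exec_while_false; rewrite /= vi iX addn1 ltnn.
move=> iX vi.
rewrite /= (setn_id vi); have [t1 e1 l1] := h s' w.
have v1 : nmem (run p s') v 0 = i.
  by have [-> //] := run_agree p s'.
have [||t2 e2 l2] := IH i.+1 (setn v 0 i.+1 (run p s')).
- by rewrite -iX addSnnS.
- exact: upd_v.
exists ((t1 + 1) + t2).+1; last first.
  by rewrite mulSn; move: (cost _ p) (m * _)%N l1 l2 => C Q l1 l2; lia.
apply: exec_while_true (exec_seq e1 (exec_nset _ _ _ _ _ _)) _.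
  by rewrite /= vi addn1 -iX -addSnnS leq_addr.
rewrite /= v1 addn1 -/(setn v 0 i.+1 _).
by case: m e2 {IH l2 iX} => [|m] /=; rewrite setnn.
Qed.

End Run.

(** * Independent systems of distinct representatives *)

Section Rado.
Variables (X T : finType) (I : {set {set X}}).
Hypothesis indep_sub :
  forall J K : {set X}, J \subset K -> K \in I -> J \in I.
Hypothesis indep_aug : forall J K : {set X}, J \in I -> K \in I ->
  (#|J| < #|K|)%N -> exists2 x, x \in K :\: J & x |: J \in I.

Lemma exchange_extend (S : finType) (Q : {set S} -> Prop) (J K : {set S}) :
  (forall J K, Q J -> Q K -> (#|J| < #|K|)%N ->
     exists2 x, x \in K :\: J & Q (x |: J)) ->
  Q J -> Q K ->
  exists L, [/\ Q L, J \subset L, L \subset J :|: K & (#|K| <= #|L|)%N].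
Proof.
move=> aug; have [n] := ubnP (#|K| - #|J|); elim: n J => // n IH J ltn QJ QK.
have [KJ|JK] := leqP #|K| #|J|; first by exists J; rewrite subxx subsetUl.
have [x /setDP[xK xJ] QxJ] := aug _ _ QJ QK JK.
have [|L [QL sJL sLJK KL]] := IH _ _ QxJ QK; first by rewrite cardsU1 xJ; lia.
exists L; split=> //; first exact: subset_trans (subsetUr _ _) sJL.
by apply: subset_trans sLJK _; rewrite -setUA subUset sub1set inE xK orbT /=.
Qed.

Definition free (G : {set X}) (x : X) : bool := (x \notin G) && (x |: G \in I).

Lemma exchange_swap (H C : {set X}) (z y : X) :
  H \in I -> C \subset H -> z \notin H -> z |: C \notin I -> y \in C ->
  z |: (C :\ y) \in I -> z |: (H :\ y) \in I.
Proof.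
move=> HI CH zH zC yC zCy.
have [L [LI sL Ls HL]] :=
  exchange_extend (Q := fun J => J \in I) indep_aug zCy HI.
have LzH : L \subset z |: H.
  apply: subset_trans Ls _; rewrite subUset subsetUr andbT setUS //.
  exact: subset_trans (subsetDl _ _) CH.
have yL : y \notin L.
  apply: contra zC => yL; apply: indep_sub _ LI.
  apply/subsetP => a; rewrite !inE => /orP[/eqP->|aC].
    by apply: (subsetP sL); rewrite !inE eqxx.
  case: (eqVneq a y) => [->//|ay]; apply: (subsetP sL).
  by rewrite !inE ay aC orbT.
suff -> : z |: (H :\ y) = L by [].
apply/esym/eqP; rewrite eqEcard; apply/andP; split.
  apply/subsetP => a aL; have := subsetP LzH a aL; rewrite !inE.
  case: (eqVneq a y) => [ay|//]; by rewrite -ay aL in yL.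
rewrite cardsU1 !inE (negbTE zH) andbF /=.
by move: HL; rewrite (cardsD1 y H) (subsetP CH).
Qed.

Variable E : T -> X -> bool.

Definition matching (U : {set T}) (rho : T -> X) : Prop :=
  [/\ {in U &, injective rho}, forall c, c \in U -> E c (rho c) &
      rho @: U \in I].

Definition matchable (U : {set T}) : Prop := exists rho, matching U rho.

Definition sink (U : {set T}) (rho : T -> X) (c : T) : bool :=
  [exists x, E c x && free (rho @: U) x].

Definition arc (U : {set T}) (rho : T -> X) (c c' : T) : bool :=
  (c' \in U) && [exists x, E c x && free (rho @: U :\ rho c') x].

Definition grow (U : {set T}) (rho : T -> X) (A : {set T}) : {set T} :=
  A :|: [set c' | [exists c in A, arc U rho c c']].

Definition reassign (rho : T -> X) (c : T) (x : X) : T -> X :=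
  fun c' => if c' == c then x else rho c'.

Implicit Types (U V A : {set T}) (rho : T -> X).

Lemma matching_sub U V rho : V \subset U -> matching U rho -> matching V rho.
Proof.
move=> VU [inj e i]; split.
- by move=> c c' /(subsetP VU) + /(subsetP VU); exact: inj.
- by move=> c /(subsetP VU); exact: e.
- by apply: indep_sub _ i; exact: imsetS.
Qed.

Lemma imset_reassign U rho c x : {in U &, injective rho} ->
  reassign rho c x @: (c |: U) =
  x |: (if c \in U then rho @: U :\ rho c else rho @: U).
Proof.
move=> inj; rewrite imsetU1 {1}/reassign eqxx; apply/setP => a; rewrite !inE.
case: (eqVneq a x) => //= ax; apply/imsetP/idP => [[c' c'U]|].
  rewrite /reassign; case: (eqVneq c' c) => [_ /eqP|c'c ->].
    by rewrite (negbTE ax).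
  case: ifP => cU; rewrite ?inE ?imset_f ?andbT //.
  by apply: contra c'c => /eqP/inj->.
case: ifP => cU; rewrite ?inE; last first.
  move=> /imsetP[c' c'U ->]; exists c' => //; rewrite /reassign.
  by case: eqP => // c'c; rewrite -c'c c'U in cU.
move=> /andP[arc /imsetP[c' c'U ac']]; exists c' => //; rewrite /reassign.
by case: eqP => // c'c; rewrite ac' c'c eqxx in arc.
Qed.

Lemma matching_reassign U rho c x :
  matching U rho -> E c x -> free (rho @: U) x ->
  matching (c |: U) (reassign rho c x).
Proof.
move=> [inj e i] cx /andP[xG xGI]; split.
- have xr c' : c' \in U -> x != rho c'.
    by move=> c'U; apply: contra xG => /eqP->; exact: imset_f.
  move=> a b; rewrite !inE /reassign.
  case: (eqVneq a c) => [->|ac]; case: (eqVneq b c) => [->|bc] //= aU bU.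
  + by move=> /eqP; rewrite (negbTE (xr _ bU)).
  + by move=> /eqP; rewrite eq_sym (negbTE (xr _ aU)).
  + exact: inj.
- by move=> a; rewrite !inE /reassign; case: (eqVneq a c) => [->|_] //= /e.
- rewrite imset_reassign //; apply: indep_sub _ xGI; apply: setUS.
  by case: ifP => _ //; exact: subsetDl.
Qed.

Lemma growE U rho A c : c \in A -> c \in grow U rho A.
Proof. by rewrite inE => ->. Qed.

Lemma iter_grow_mono U rho A j k : (j <= k)%N ->
  iter j (grow U rho) A \subset iter k (grow U rho) A.
Proof.
elim: k => [|k IH]; first by rewrite leqn0 => /eqP->.
rewrite leq_eqVlt => /orP[/eqP->//|jk].
exact: subset_trans (IH jk) (subsetUl _ _).
Qed.

(* The last step of a shortest path from A to a sink c: once c is reassigned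
   to a free point, its predecessor becomes a sink, and the path up to the
   predecessor survives because it has no shortcut to c. *)
Lemma reassign_reach U rho A k c x :
  matching U rho ->
  c \in iter k.+1 (grow U rho) A -> c \notin iter k (grow U rho) A ->
  (forall c', c' \in iter k (grow U rho) A -> ~~ sink U rho c') ->
  E c x -> free (rho @: U) x ->
  exists2 c', c' \in iter k (grow U (reassign rho c x)) A &
    sink U (reassign rho c x) c'.
Proof.
move=> mU cA' cA nosink Ecx fx; have [inj e GI] := mU.
have [cU [c1 c1A [x1 Ec1 fx1]]] : c \in U /\ exists2 c1,
    c1 \in iter k (grow U rho) A &
    exists2 x1, E c1 x1 & free (rho @: U :\ rho c) x1.
  move: cA'; rewrite /= inE (negbTE cA) inE => /existsP[c1].
  by case/andP=> c1A /andP[cU /existsP[x1 /andP[? ?]]]; split=> //; exists c1;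
    last exists x1.
have nosinkP c2 z : c2 \in iter k (grow U rho) A -> E c2 z ->
    ~~ free (rho @: U) z.
  move=> /nosink/existsPn/(_ z); by case: (E c2 z).
set G := rho @: U in fx fx1 nosinkP GI *; set y := rho c in fx1 *.
have yG : y \in G by exact: imset_f.
case/andP: (fx) => xG xGI.
have xy : x != y by apply: contra xG => /eqP->.
have [_ _] := matching_reassign mU Ecx fx.
have -> : c |: U = U by apply/setUidPr; rewrite sub1set.
have : reassign rho c x @: U = x |: (G :\ y).
  by have := imset_reassign c x inj; rewrite cU (setUidPr _) ?sub1set.
rewrite /sink; set rho' := reassign rho c x; move=> G'E; rewrite G'E => G'I.
have G'xy : x |: (G :\ y) = (x |: G) :\ y.
  apply/setP => a; rewrite !inE.
  by case: (eqVneq a x) => [->|]; rewrite ?xy ?andbT.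
exists c1; last first.
  apply/existsP; exists x1; rewrite Ec1 /=; apply/andP.
  case/andP: fx1 => x1Gy x1GyI.
  have := nosinkP _ _ c1A Ec1; rewrite negb_and negbK => /orP[x1G|x1GI].
    have x1y : x1 = y by apply/eqP; apply: contraR x1Gy => h; rewrite !inE h.
    rewrite x1y; split; first by rewrite !inE eqxx eq_sym (negbTE xy).
    by rewrite G'xy setD1K // inE yG orbT.
  have x1x : x1 != x by apply: contra x1GI => /eqP->.
  have x1nG : x1 \notin G.
    apply: contra x1GI => x1G; by rewrite (setUidPr _) ?sub1set.
  split; first by rewrite !inE (negbTE x1x) (negbTE x1nG) andbF.
  rewrite G'xy; apply: exchange_swap xGI (subsetUr _ _) _ x1GI yG x1GyI.
  by rewrite !inE (negbTE x1x).
suff sub j : (j <= k)%N ->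
    iter j (grow U rho) A \subset iter j (grow U rho') A.
  exact: (subsetP (sub k (leqnn k))).
elim: j => // j IH jk; apply/subsetP => c3 /=.
have jk' := ltnW jk.
rewrite inE => /orP[/(subsetP (IH jk'))/growE//|]; rewrite inE.
move=> /existsP[c2 /andP[c2A ac]]; rewrite inE; apply/orP; right; rewrite inE.
apply/existsP; exists c2; rewrite (subsetP (IH jk')) //=.
case/andP: (ac) => c3U /existsP[z /andP[Ez /andP[zG zGI]]].
have c3A : c3 \in iter k (grow U rho) A.
  apply: (subsetP (iter_grow_mono U rho A jk)); rewrite /= inE; apply/orP.
  by right; rewrite inE; apply/existsP; exists c2; rewrite c2A.
have c3c : c3 != c by apply: contra cA => /eqP<-.
have nfree : ~~ free (G :\ y) z.
  apply: contra cA => fz; apply: (subsetP (iter_grow_mono U rho A jk)).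
  rewrite /= inE; apply/orP; right; rewrite inE; apply/existsP; exists c2.
  by rewrite c2A /arc cU; apply/existsP; exists z; rewrite Ez.
rewrite /arc c3U; apply/existsP; exists z; rewrite Ez /= G'E.
have -> : rho' c3 = rho c3 by rewrite /rho' /reassign (negbTE c3c).
have y3y : rho c3 != y by apply: contra c3c => /eqP/inj->.
have y3G : rho c3 \in G by exact: imset_f.
have c2A' := subsetP (iter_grow_mono U rho A jk') _ c2A.
have := nosinkP _ _ c2A' Ez; rewrite negb_and negbK => /orP[zinG|zGI'].
  have zy3 : z = rho c3 by apply/eqP; apply: contraR zG => h; rewrite !inE h.
  rewrite /free zy3 !inE eqxx /= setD1K // !inE y3y y3G orbT //.
have zx : z != x by apply: contra zGI' => /eqP->.
have znG : z \notin G.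
  by apply: contra zGI' => h; rewrite (setUidPr _) ?sub1set.
rewrite /free !inE (negbTE zx) (negbTE znG) !andbF /=.
have zGy : z |: (G :\ y) \notin I.
  by move: nfree; rewrite /free !inE (negbTE znG) andbF.
apply: exchange_swap G'I (subsetUr _ _) _ zGy _ _.
- by rewrite !inE (negbTE zx) (negbTE znG) andbF.
- by rewrite !inE y3y.
- apply: indep_sub _ zGI; apply: setUS; apply: setSD; exact: subsetDl.
Qed.

(* The points available to the centers in a closed set A without sinks are
   spanned by the representatives of U :&: A. *)
Lemma closed_bound U rho A K :
  matching U rho -> grow U rho A = A ->
  (forall c, c \in A -> ~~ sink U rho c) ->
  matchable K -> (#|K :&: A| <= #|U :&: A|)%N.
Proof.
move=> [inj e GI] cl nosink [sigma [sinj se sI]].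
have cUA : #|rho @: (U :&: A)| = #|U :&: A|.
  by apply: card_in_imset => a b; rewrite !inE => /andP[aU _] /andP[bU _];
    exact: inj.
have cKA : #|sigma @: (K :&: A)| = #|K :&: A|.
  by apply: card_in_imset => a b; rewrite !inE => /andP[aU _] /andP[bU _];
    exact: sinj.
set G := rho @: U in GI; set GA := rho @: (U :&: A) in cUA.
have sGA : GA \subset G by apply: imsetS; exact: subsetIl.
have GAI : GA \in I by apply: indep_sub sGA GI.
have sKI : sigma @: (K :&: A) \in I.
  by apply: indep_sub _ sI; apply: imsetS; exact: subsetIl.
have arcA c c' x : c \in A -> c' \in U -> E c x -> free (G :\ rho c') x ->
    rho c' \in GA.
  move=> cA c'U Ex fx; apply: imset_f; rewrite inE c'U /= -cl inE; apply/orP.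
  right; rewrite inE; apply/existsP; exists c; rewrite cA /arc c'U.
  by apply/existsP; exists x; rewrite Ex.
rewrite -cUA -cKA leqNgt; apply/negP => lt.
have [x /setDP[/imsetP[c]]] := indep_aug GAI sKI lt.
rewrite inE => /andP[cK cA] xc xGA xGAI.
have Ex : E c x by rewrite xc; exact: se.
have xG : x \notin G.
  apply: contra xGA => /imsetP[c' c'U xc']; rewrite xc'.
  apply: (arcA _ _ _ cA c'U Ex).
  by rewrite /free xc' !inE eqxx /= setD1K ?imset_f.
have xGI : x |: G \notin I.
  move: (nosink c cA) => /existsPn/(_ x); by rewrite Ex /free xG.
have [L [LI sL Ls HL]] :=
  exchange_extend (Q := fun J => J \in I) indep_aug xGAI GI.
have LxG : L \subset x |: G.
  by apply: subset_trans Ls _; rewrite subUset subsetUr andbT setUS.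
have : ~~ (x |: G \subset L).
  by apply: contra xGI => h; apply: indep_sub h LI.
move=> /subsetPn[y yxG yL].
have xL : x \in L by apply: (subsetP sL); rewrite !inE eqxx.
have yx : y != x by apply: contra yL => /eqP->.
have yG : y \in G by move: yxG; rewrite !inE (negbTE yx).
case/imsetP: (yG) => c' c'U yc'.
have : rho c' \in GA.
  apply: (arcA _ _ _ cA c'U Ex); rewrite /free !inE (negbTE xG) andbF /= -yc'.
  suff -> : x |: (G :\ y) = L by [].
  apply/esym/eqP; rewrite eqEcard; apply/andP; split.
    apply/subsetP => a aL; have := subsetP LxG a aL; rewrite !inE.
    case: (eqVneq a y) => [ay|//]; by rewrite -ay aL in yL.
  rewrite cardsU1 !inE (negbTE xG) andbF /=.
  by move: HL; rewrite (cardsD1 y G) yG.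
rewrite -yc' => yGA; move/negP: yL; apply; apply: (subsetP sL).
by rewrite !inE yGA orbT.
Qed.

Lemma iter_grow_closed U rho A : A != set0 ->
  let B := iter #|T|.-1 (grow U rho) A in grow U rho B = B.
Proof.
move=> A0 /=.
have step k : grow U rho (iter k (grow U rho) A) = iter k (grow U rho) A \/
    (k < #|iter k (grow U rho) A|)%N.
  elim: k => [|k [IH|IH]]; first by right; rewrite card_gt0.
    by left; rewrite /= IH.
  case: (eqVneq (grow U rho (iter k (grow U rho) A)) (iter k (grow U rho) A)).
    by move=> h; left; rewrite /= h.
  move=> ne; right; apply: leq_ltn_trans IH _; apply: proper_card.
  by rewrite properEneq eq_sym ne subsetUl.
case: (step #|T|.-1) => // h; apply/eqP; rewrite eq_sym eqEcard subsetUl /=.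
apply: leq_trans (max_card _) _.
by case: (posnP #|T|) => [->//|T0]; rewrite prednK in h.
Qed.

Lemma sink_matchable U rho A k c : matching U rho -> [disjoint A & U] ->
  c \in iter k (grow U rho) A -> sink U rho c ->
  exists2 u, u \in A & matchable (u |: U).
Proof.
elim: k rho c => [|k IH] rho c mU AU cA sc.
  exists c => //; case/existsP: sc => x /andP[Ex fx].
  by exists (reassign rho c x); exact: matching_reassign.
case: (boolP [exists c' in iter k (grow U rho) A, sink U rho c']).
  by move=> /existsP[c' /andP[c'A sc']]; exact: (IH rho c').
move=> /existsPn nosink.
have nosink' c' : c' \in iter k (grow U rho) A -> ~~ sink U rho c'.
  by move=> h; move: (nosink c'); rewrite h.
have cnA : c \notin iter k (grow U rho) A.
  by apply: contraL sc => /nosink'.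
case/existsP: sc => x /andP[Ex fx].
have [c' c'A sc'] := reassign_reach mU
  cA cnA nosink' Ex fx.
apply: IH c'A sc' => //.
have cU : c \in U.
  by move: cA; rewrite /= inE (negbTE cnA) inE => /existsP[c1 /and3P[]].
have := matching_reassign mU Ex fx.
by have -> : c |: U = U by apply/setUidPr; rewrite sub1set.
Qed.

Lemma matchable_aug (J K : {set T}) : matchable J -> matchable K ->
  (#|J| < #|K|)%N -> exists2 x, x \in K :\: J & matchable (x |: J).
Proof.
move=> [rho mJ] mK lt; set A := K :\: J.
have A0 : A != set0.
  rewrite -card_gt0 /A cardsD; have := subset_leq_card (subsetIr K J); lia.
have AJ : [disjoint A & J].
  by rewrite -setI_eq0 /A setDE -setIA (setIC (~: J)) setICr setI0.
set B := iter #|T|.-1 (grow J rho) A.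
case: (boolP [exists c in B, sink J rho c]).
  by move=> /existsP[c /andP[cB sc]]; exact: sink_matchable mJ AJ cB sc.
move=> /existsPn nosink.
have nosink' c : c \in B -> ~~ sink J rho c.
  by move=> h; move: (nosink c); rewrite h.
have := closed_bound mJ (iter_grow_closed J rho A0) nosink' mK.
rewrite -/B => le.
have AB : A \subset B := iter_grow_mono J rho A (leq0n _).
have : (#|K :\: B| <= #|J :\: B|)%N.
  apply: subset_leq_card; apply/subsetP => a; rewrite !inE => /andP[aB aK].
  rewrite aB /=; apply: contraR aB => aJ; apply: (subsetP AB).
  by rewrite inE aJ.
have := cardsID B K; have := cardsID B J; lia.
Qed.

Lemma no_sink_unmatchable U rho u : matching U rho -> u \notin U ->
  (forall c, c \in iter #|T|.-1 (grow U rho) [set u] -> ~~ sink U rho c) ->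
  ~ matchable (u |: U).
Proof.
move=> mU uU nosink mu; set B := iter _ _ _ in nosink.
have s0 : [set u] != set0 by rewrite -card_gt0 cards1.
have := closed_bound mU (iter_grow_closed U rho s0) nosink mu.
have uB : u \in B.
  apply: (subsetP (iter_grow_mono U rho [set u] (leq0n _))); exact: set11.
have -> : (u |: U) :&: B = u |: (U :&: B).
  by rewrite setIUl (setIidPl _) // sub1set.
by rewrite cardsU1 inE (negbTE uU) /= ltnn.
Qed.

End Rado.

(** * The greedy exchange argument *)

Section Greedy.
Variables (R : realType) (X : finMetricType R) (P : rmc_instance X) (r : R).
Hypothesis r0 : 0 <= r.
Implicit Types (U A B Fr : {set X}) (u c x : X).

Let indep_sub := @matroid_sub _ _ _ (indep_matroid P).
Let indep_aug := @matroid_aug _ _ _ (indep_matroid P).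

Definition near c x : bool := mdist c x <= r + r.

Definition cover U : {set X} := fballs U (r + r + r).

Definition gain A u : R := Defs.total (weight P) (fball u r :\: A).

(* The points of Fr, chosen by a hypothetical solution, represent themselves. *)
Definition near_or_self Fr c x : bool :=
  if c \in Fr then x == c else near c x.

Definition greedy_inv (done U : {set X}) : Prop :=
  U \subset done /\
  ((exists F, rmc_solution P r F) ->
   exists Fr, [/\ [disjoint Fr & done],
     matchable (indep P) (near_or_self Fr) (U :|: Fr) &
     target P <= Defs.total (weight P) (cover U :|: fballs Fr r)]).

Lemma nearxx c : near c c.
Proof. by rewrite /near mdistxx addr_ge0. Qed.

Lemma total_sub A B :
  A \subset B -> Defs.total (weight P) A <= Defs.total (weight P) B.
Proof.
move=> AB; rewrite /Defs.total [leRHS](big_setID A) /= (setIidPr AB) lerDl.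
by apply: sumr_ge0 => a _; exact: weight_ge0.
Qed.

Lemma totalU A B :
  Defs.total (weight P) (A :|: B) =
  Defs.total (weight P) A + Defs.total (weight P) (B :\: A).
Proof.
rewrite {1}/Defs.total (big_setID A) /= setDUl setDv set0U.
by rewrite (setIidPr _) // subsetUl.
Qed.

Lemma fballsU A B (q : R) : fballs (A :|: B) q = fballs A q :|: fballs B q.
Proof. exact: bigcup_setU. Qed.

Lemma fballs1 u (q : R) : fballs [set u] q = fball u q.
Proof. exact: big_set1. Qed.

Lemma fballsS A B (q : R) : A \subset B -> fballs A q \subset fballs B q.
Proof. by move=> /setUidPr <-; rewrite fballsU subsetUl. Qed.

Lemma coverU1 u U : cover (u |: U) = fball u (r + r + r) :|: cover U.
Proof. by rewrite /cover fballsU fballs1. Qed.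

Lemma matchable_mono (E E' : X -> X -> bool) U :
  (forall c x, c \in U -> E c x -> E' c x) ->
  matchable (indep P) E U -> matchable (indep P) E' U.
Proof.
move=> EE' [rho [inj e i]]; exists rho; split=> // c cU.
by apply: EE' => //; exact: e.
Qed.

Lemma near_or_selfS Fr c x : near_or_self Fr c x -> near c x.
Proof. by rewrite /near_or_self; case: ifP => // _ /eqP->; exact: nearxx. Qed.

Lemma greedy_inv0 : greedy_inv set0 set0.
Proof.
split=> [|[F [FI mF]]]; first exact: subxx.
exists F; split.
- by rewrite disjoint_sym -setI_eq0 set0I.
- exists id; rewrite set0U; split=> // [c cF|]; last by rewrite imset_id.
  by rewrite /near_or_self cF.
- apply: le_trans mF (total_sub _); exact: subsetUr.
Qed.

Lemma greedy_inv_skip done U u : greedy_inv done U ->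
  ~ matchable (indep P) near (u |: U) -> greedy_inv (u |: done) U.
Proof.
move=> [Ud H] nm; split; first exact: subset_trans Ud (subsetUr _ _).
move=> /H[Fr [dis [rho mr] wF]]; exists Fr; split=> //; last by exists rho.
have uF : u \notin Fr.
  apply/negP => uF; apply: nm.
  apply: (matchable_mono (E := near_or_self Fr)).
    by move=> c x _; exact: near_or_selfS.
  exists rho; apply: matching_sub mr => //.
  by rewrite setUC setUS // sub1set.
rewrite -setI_eq0 setIUr; apply/eqP; move: dis; rewrite -setI_eq0 => /eqP->.
by rewrite setU0; apply/eqP; rewrite setI_eq0 disjoint_sym disjoints1.
Qed.

Lemma disjointsU1r Fr u A :
  u \notin Fr -> [disjoint Fr & A] -> [disjoint Fr & u |: A].
Proof.
move=> uF; rewrite -!setI_eq0 setIUr => /eqP->; rewrite setU0.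
by rewrite setI_eq0 disjoint_sym disjoints1.
Qed.

Lemma greedy_inv_add done U u : greedy_inv done U -> u \notin done ->
  matchable (indep P) near (u |: U) ->
  (forall v, v \notin done -> gain (cover U) v <= gain (cover U) u) ->
  greedy_inv (u |: done) (u |: U).
Proof.
move=> [Ud H] ud mu best; split; first exact: setUS.
move=> /H[Fr [dis mF wF]].
have uU : u \notin U by apply: contra ud; exact: (subsetP Ud).
have FU c : c \in Fr -> c \notin U.
  by move=> cF; apply: contraL cF => /(subsetP Ud) cd;
    rewrite (disjointFl dis cd).
case: (boolP [exists f in Fr, near u f]) => [/existsP[f0 /andP[f0F uf0]]|].
  have [f [fF uf fu]] : exists f, [/\ f \in Fr, near u f &
      u \in Fr -> f = u].
    case: (boolP (u \in Fr)) => uF; last by exists f0.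
    by exists u; rewrite nearxx.
  have uF' : u \notin Fr :\ f.
    by rewrite !inE; apply/negP => /andP[+ /fu fE]; rewrite fE eqxx.
  exists (Fr :\ f); split.
  - apply: disjointsU1r => //; apply: disjointWl dis; exact: subsetDl.
  - case: mF => rho [inj e i].
    have rf : rho f = f.
      by apply/eqP; have := e f; rewrite !inE fF orbT /near_or_self fF; exact.
    pose g c := if c == u then f else c.
    have gin c : c \in u |: U :|: Fr :\ f -> g c \in U :|: Fr.
      rewrite !inE /g; case: eqP => [_ _|_ /=]; first by rewrite fF orbT.
      by case/orP=> [->//|/andP[_ ->]]; rewrite orbT.
    have nf c : c \in u |: U :|: Fr :\ f -> c != u -> c != f.
      rewrite !inE => + /negbTE cu; rewrite cu /=.
      case/orP=> [cU|/andP[]//]; apply: contraL cU => /eqP->; exact: FU.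
    exists (rho \o g); split.
    + move=> a b aS bS /= /inj -/(_ (gin _ aS) (gin _ bS)); rewrite /g.
      case: (eqVneq a u) => [->|au]; case: (eqVneq b u) => [->|bu] //.
        by move=> fb; have := nf b bS bu; rewrite -fb eqxx.
      by move=> fa; have := nf a aS au; rewrite fa eqxx.
    + move=> c cS; rewrite /= /near_or_self /g.
      case: (eqVneq c u) => [->|cu]; first by rewrite (negbTE uF') rf.
      have cf := nf c cS cu.
      have cUF : c \in U :|: Fr by move: (gin c cS); rewrite /g (negbTE cu).
      by have := e c cUF; rewrite /near_or_self !inE cf.
    + apply: indep_sub i; rewrite imset_comp; apply: imsetS.
      by apply/subsetP => _ /imsetP[c cS ->]; exact: gin.
  apply: le_trans wF (total_sub _).
  rewrite coverU1 -{1}(setD1K fF) fballsU fballs1.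
  apply/subsetP => a; rewrite !inE => /or3P[-> | fa |->]; rewrite ?orbT //.
  apply/orP; left; apply/orP; left.
  by apply: le_trans (metric_triangle _ f _) _; exact: lerD.
move=> /existsPn far.
have farP f : f \in Fr -> ~~ near u f by move=> fF; move: (far f); rewrite fF.
have uF : u \notin Fr by apply/negP => /farP; rewrite nearxx.
have mJ : matchable (indep P) (near_or_self Fr) (u |: U).
  apply: matchable_mono mu => c x cS; rewrite /near_or_self.
  case: ifP => // cF; move: cS; rewrite !inE (negbTE (FU _ cF)) orbF.
  by move=> /eqP cu; rewrite -cu cF in uF.
have [K [mK JK KJ cK]] := exchange_extend
  (matchable_aug indep_sub indep_aug (E := near_or_self Fr)) mJ mF.
set F' := Fr :&: K.
have KE : K = (u |: U) :|: F'.
  apply/setP => c; rewrite inE; apply/idP/orP => [cK'|].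
    move: (subsetP KJ c cK'); rewrite !inE cK' andbT orbA.
    by case: (c == u); case: (c \in U); case: (c \in Fr); auto.
  by case=> [/(subsetP JK)//|]; rewrite inE => /andP[].
have dFU : [disjoint Fr & U].
  by rewrite disjoint_subset; apply/subsetP => c /FU.
have cF' : (#|Fr| <= #|F'|.+1)%N.
  have UFr0 : U :&: Fr = set0 by apply/eqP; rewrite setIC setI_eq0.
  move: cK; rewrite KE cardsU UFr0 cards0 subn0 => cK.
  have := leq_trans cK (leq_card_setU _ _).
  by rewrite cardsU1 uU -addnA addnCA leq_add2l add1n.
exists F'; split.
- apply: disjointsU1r; first by rewrite inE (negbTE uF).
  apply: disjointWl dis; exact: subsetIl.
- rewrite -KE; apply: matchable_mono mK => c x cK'.
  by rewrite /near_or_self !inE cK' andbT.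
apply: le_trans wF _.
have disj : [disjoint fball u r & fballs Fr r].
  rewrite -setI_eq0; apply/eqP/setP => a; rewrite !inE; apply/negP.
  move=> /andP[ua /bigcupP[f fF]]; rewrite inE => fa.
  move/negP: (farP f fF); apply; rewrite /near.
  apply: le_trans (metric_triangle _ a _) _; rewrite lerD //.
  by rewrite metric_sym.
have [FF'|] := boolP (Fr \subset F').
  apply: total_sub; rewrite coverU1 -setUA subsetU // orbC.
  by apply/orP; left; apply: setUS; exact: fballsS.
move=> /subsetPn[f fF fF'].
have Ff : Fr \subset f |: F'.
  have : f |: F' == Fr.
    rewrite eqEcard subUset sub1set fF subsetIl cardsU1 fF'.
    by rewrite add1n.
  by move=> /eqP->.
apply: (le_trans (y := Defs.total (weight P)
  (fball f r :|: (cover U :|: fballs F' r)))).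
  apply: total_sub; rewrite setUCA setUS //.
  by rewrite -fballs1 -fballsU; exact: fballsS.
apply: (le_trans (y := Defs.total (weight P)
  (fball u r :|: (cover U :|: fballs F' r)))); last first.
  apply: total_sub; rewrite coverU1 -setUA; apply: setSU.
  apply/subsetP => a; rewrite !inE => /le_trans; apply.
  by rewrite lerDr addr_ge0.
rewrite ![_ :|: (_ :|: _)]setUC !totalU lerD2l.
apply: (le_trans (y := gain (cover U) f)).
  by apply: total_sub; apply: setDS; exact: subsetUl.
apply: le_trans (best f _) _.
  by rewrite (disjointFr dis fF).
apply: total_sub; apply/subsetP => a; rewrite !inE => /andP[/negbTE-> ua] /=.
rewrite ua andbT; apply/negP => /(subsetP (fballsS _ (subsetIl _ _))) aF.
have au : a \in fball u r by rewrite inE.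
by rewrite (disjointFr disj au) in aF.
Qed.

Lemma greedy_inv_final U rho : greedy_inv setT U ->
  matching (indep P) near U rho ->
  (exists F, rmc_solution P r F) -> rmc_solution P (5 * r) (rho @: U).
Proof.
move=> [_ H] [_ e i] /H[Fr [dis _ wF]]; split=> //.
apply: le_trans wF (total_sub _).
have -> : Fr = set0.
  by apply/eqP; move: dis; rewrite -setI_eq0 setIT.
rewrite (_ : fballs set0 r = set0) ?setU0; last exact: big_set0.
apply/subsetP => a /bigcupP[c cU].
rewrite inE => ca; apply/bigcupP; exists (rho c); first exact: imset_f.
rewrite inE; apply: le_trans (metric_triangle _ c _) _.
have := e c cU; rewrite /near metric_sym; move: ca.
set d1 := mdist _ _; set d2 := mdist _ _; lra.
Qed.

End Greedy.

(** * The program and its correctness *)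

Section For.
Variables (R : realType) (X : finMetricType R) (P : rmc_instance X) (r : R).
Implicit Types (s : state R) (p : prog) (x c : X) (S D G U : {set X}).

Definition idx x : nat := index x (enum X).

Lemma idx_eq x c : (idx x == idx c) = (x == c).
Proof.
apply/eqP/eqP => [h|->//]; rewrite -(nth_index x (mem_enum X x)).
by rewrite -/(idx x) h nth_index // mem_enum.
Qed.

Lemma point_idx x : point X (idx x) = Some x.
Proof.
by rewrite /point /idx onthE (nth_map x) ?nth_index ?index_mem ?mem_enum.
Qed.

Lemma run_for (Inv : {set X} -> state R -> Prop) v p s0 :
  Inv set0 s0 ->
  (forall D s k, Inv D s -> Inv D (setn v 0 k s)) ->
  (forall D x s, x \notin D -> agree (v :: nwrites p) (rwrites p) s0 s ->
     nmem s v 0 = idx x -> Inv D s -> Inv (x |: D) (run P r p s)) ->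
  Inv setT (run P r (PFor v p) s0).
Proof.
move=> I0 Iv step /=; apply: (Iv).
have vin : v \in v :: nwrites p by rewrite inE eqxx.
suff loop l D s : uniq l -> (forall x, (x \in l) = (x \notin D)) ->
    agree (v :: nwrites p) (rwrites p) s0 s -> Inv D s ->
    Inv setT (foldl (fun s i => run P r p (setn v 0 i s)) s (map idx l)).
  have -> : iota 0 #|X| = map idx (enum X).
    have sX : size (enum X) = #|X| by rewrite cardE.
    apply: (@eq_from_nth _ 0%N); first by rewrite size_iota size_map sX.
    rewrite size_iota => i iX; rewrite nth_iota // add0n.
    have [x0 _] : exists x0 : X, x0 \in enum X.
      move: iX; rewrite -sX; case: (enum X) => // x0 l.
      by exists x0; rewrite inE eqxx.
    by rewrite (nth_map x0) ?sX // /idx index_uniq ?enum_uniq ?sX.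
  apply: (loop _ set0 s0 (enum_uniq _)) => // x.
  by rewrite mem_enum !inE.
elim: l D s => [|x l IH] D s /=.
  move=> _ Dl _; have -> // : D = setT.
  by apply/setP => x; have := Dl x; rewrite !inE; case: (x \in D).
move=> /andP[xl ul] Dl ag ID.
have xD : x \notin D by rewrite -Dl inE eqxx.
have ag' := agree_trans ag (setn_agree (rwrites p) 0 (idx x) s vin).
apply: (IH (x |: D)) => //.
- move=> y; have := Dl y; rewrite !inE; case: (eqVneq y x) => [->|] //=.
  by rewrite (negbTE xl).
- apply: (agree_trans ag').
  apply: agree_sub (run_agree P r p _) => // a.
  by rewrite inE => ->; rewrite orbT.
- apply: step => //; first by rewrite /= /upd !eqxx.
  exact: Iv.
Qed.

Lemma nmem_setn a i v s b j : nmem (setn a i v s) b j =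
  if (b == a) && (j == i) then v else nmem s b j.
Proof. by []. Qed.

Lemma stored_agree nw rw s s' a :
  agree nw rw s s' -> a \notin nw -> stored_set X s' a = stored_set X s a.
Proof. by move=> [h _] /h e; apply/setP => x; rewrite !inE e. Qed.

Lemma stored_on a x s :
  stored_set X (setn a (idx x) 1 s) a = x |: stored_set X s a.
Proof.
by apply/setP => y; rewrite !inE nmem_setn eqxx /= idx_eq; case: (y == x).
Qed.

Lemma stored_off a x s :
  stored_set X (setn a (idx x) 0 s) a = stored_set X s a :\ x.
Proof.
by apply/setP => y; rewrite !inE nmem_setn eqxx /= idx_eq; case: (y == x).
Qed.

Lemma stored_cell a x s :
  (0 < nmem s a (idx x))%N = (x \in stored_set X s a).
Proof. by rewrite inE lt0n. Qed.

Lemma weight_idx x : weight_at P (idx x) = weight P x.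
Proof. by rewrite /weight_at point_idx. Qed.

Lemma dist_idx x c : dist_at X (idx x) (idx c) = mdist x c.
Proof. by rewrite /dist_at !point_idx. Qed.

End For.

Definition isset (a : nat) (e : nexp) : bexp := BNle (NConst 1) (NGet a e).
Definition on (a : nat) (e : nexp) : prog := PN a e (NConst 1).
Definition off (a : nat) (e : nexp) : prog := PN a e (NConst 0).
Definition assign (v : nat) (e : nexp) : prog := PN v (NConst 0) e.
Definition unless (b : bexp) (p : prog) : prog := PIf b PSkip p.
Definition when (b : bexp) (p : prog) : prog := PIf b p PSkip.

(* Memory map.  Sets of points: 0 the representatives, 1 the processed points,
   2 the chosen centers, 4 the covered points, 5 and 6 the centers reached by
   the search.  The array 3 maps a chosen center to its representative.
   Scalars: 7 the candidate, 8 whether there is one, 9 whether a sink was found,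
   17 and 18 the sink found and its new representative, 10-16 loop counters;
   reals: 0 the current gain, 1 the best gain. *)

Definition p_find : prog :=
  PFor 13 (when (isset 5 (cell 13)) (PFor 14
    (when (BAnd (BNot (isset 9 (NConst 0)))
            (BAnd (BRle (RDist (cell 13) (cell 14)) (RAdd RRadius RRadius))
               (BNot (isset 0 (cell 14)))))
       (PSeq (on 0 (cell 14))
          (PSeq (when (BIndep 0)
                   (PSeq (on 9 (NConst 0))
                      (PSeq (assign 17 (cell 13)) (assign 18 (cell 14)))))
             (off 0 (cell 14))))))).

Definition p_expand : prog :=
  PSeq
    (PFor 15 (when (isset 2 (cell 15))
       (PSeq (off 0 (NGet 3 (cell 15)))
          (PSeq p_find
             (PSeq (on 0 (NGet 3 (cell 15)))
                (when (isset 9 (NConst 0))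
                   (PSeq (on 6 (cell 15)) (off 9 (NConst 0)))))))))
    (PFor 13 (when (isset 6 (cell 13)) (on 5 (cell 13)))).

Definition p_swap : prog :=
  PSeq (when (isset 2 (cell 17)) (off 0 (NGet 3 (cell 17))))
    (PSeq (on 0 (cell 18))
       (PSeq (on 2 (cell 17)) (PN 3 (cell 17) (cell 18)))).

Definition p_search : prog :=
  PSeq (PFor 13 (PSeq (off 5 (cell 13)) (off 6 (cell 13))))
    (PSeq (on 5 (cell 7))
       (PSeq (off 9 (NConst 0))
          (PSeq
             (PFor 12 (unless (isset 9 (NConst 0))
                (PSeq p_find (unless (isset 9 (NConst 0)) p_expand))))
             (when (isset 9 (NConst 0)) p_swap)))).

Definition p_augment : prog := PFor 11 (unless (isset 2 (cell 7)) p_search).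

Definition p_gain : prog :=
  PSeq (PR 0 (NConst 0) RZero)
    (PFor 16 (when (BAnd (BRle (RDist (cell 13) (cell 16)) RRadius)
                      (BNot (isset 4 (cell 16))))
       (PR 0 (NConst 0) (RAdd (RGet 0 (NConst 0)) (RWeight (cell 16)))))).

Definition p_pick : prog :=
  PSeq (off 8 (NConst 0))
    (PFor 13 (unless (isset 1 (cell 13))
       (PSeq p_gain
          (unless (BAnd (isset 8 (NConst 0))
                    (BNot (BRle (RGet 1 (NConst 0)) (RGet 0 (NConst 0)))))
             (PSeq (on 8 (NConst 0))
                (PSeq (assign 7 (cell 13))
                   (PR 1 (NConst 0) (RGet 0 (NConst 0))))))))).

Definition p_cover : prog :=
  PFor 16 (when (BRle (RDist (cell 7) (cell 16))
                   (RAdd (RAdd RRadius RRadius) RRadius))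
    (on 4 (cell 16))).

Definition p_main : prog :=
  PFor 10 (PSeq p_pick
    (when (isset 8 (NConst 0))
       (PSeq (on 1 (cell 7))
          (PSeq p_augment (when (isset 2 (cell 7)) p_cover))))).

Lemma wf_p_main : wf p_main.
Proof. by []. Qed.

Section Correct.
Variables (R : realType) (X : finMetricType R) (P : rmc_instance X) (r : R).
Hypothesis r0 : 0 <= r.
Implicit Types (s : state R) (x c u : X) (S D G U : {set X}) (rho : X -> X).

Let indep_sub := @matroid_sub _ _ _ (indep_matroid P).
Let indep_aug := @matroid_aug _ _ _ (indep_matroid P).

Local Notation I := (indep P).
Local Notation st s a := (stored_set X s a).
Local Notation run := (run P r).
Local Notation E := (near r).

Lemma run_seq p1 p2 s : run (PSeq p1 p2) s = run p2 (run p1 s).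
Proof. by []. Qed.

Lemma run_when b p s :
  run (when b p) s = if beval P r s b then run p s else s.
Proof. by []. Qed.

Lemma run_unless b p s :
  run (unless b p) s = if beval P r s b then s else run p s.
Proof. by []. Qed.

Lemma run_on a e s : run (on a e) s = setn a (neval X s e) 1 s.
Proof. by []. Qed.

Lemma run_off a e s : run (off a e) s = setn a (neval X s e) 0 s.
Proof. by []. Qed.

Lemma eval_isset a e s :
  beval P r s (isset a e) = (0 < nmem s a (neval X s e))%N.
Proof. by []. Qed.

Lemma eval_cell v s : neval X s (cell v) = nmem s v 0.
Proof. by []. Qed.

Definition found_spec G (Q : X -> X -> bool) s : Prop :=
  if nmem s 9 0 == 0%N then
    forall c x, Q c x -> E c x -> ~~ free I G x
  else exists c x, [/\ Q c x, E c x, free I G x &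
    nmem s 17 0 = idx c /\ nmem s 18 0 = idx x].

Lemma found_spec_eq G (Q Q' : X -> X -> bool) s :
  Q =2 Q' -> found_spec G Q s -> found_spec G Q' s.
Proof.
move=> QQ; rewrite /found_spec; case: ifP => _.
  by move=> H c x; rewrite -QQ; exact: H.
by move=> [c [x []]]; rewrite QQ => *; exists c, x.
Qed.

Lemma p_find_spec s :
  nmem s 9 0 = 0%N ->
  let s' := run p_find s in
  st s' 0 = st s 0 /\ found_spec (st s 0) (fun c _ => c \in st s 5) s'.
Proof.
move=> f0; set G := st s 0; set S := st s 5.
pose Inv D s' := st s' 0 = G /\
  found_spec G (fun c _ => (c \in S) && (c \in D)) s'.
suff [? H] : Inv setT (run p_find s).
  by split=> //; apply: found_spec_eq H => a b /=; rewrite in_setT andbT.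
rewrite /p_find; apply: run_for.
- by split=> //; rewrite /found_spec f0 eqxx => c x /=; rewrite in_set0 andbF.
- by move=> D s1 k [].
move=> D c s1 cD ag v13 [G1 F1].
have S1 : st s1 5 = S by rewrite (stored_agree _ ag).
rewrite run_when eval_isset eval_cell v13 stored_cell S1.
case: ifP => cS; last first.
  split=> //; apply: found_spec_eq F1 => a b /=; rewrite in_setU1.
  by case: (eqVneq a c) => [->|] //=; rewrite cS.
set q := when _ _.
pose Inv2 D' s' := [/\ st s' 0 = G, nmem s' 13 0 = idx c &
  found_spec G (fun a b => (a \in S) &&
    ((a \in D) || ((a == c) && (b \in D')))) s'].
suff [? _ H] : Inv2 setT (run (PFor 14 q) s1).
  split=> //; apply: found_spec_eq H => a b /=.
  by rewrite in_setT in_setU1 andbT orbC.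
apply: run_for.
- split=> //; apply: found_spec_eq F1 => a b /=.
  by rewrite in_set0 andbF orbF.
- by move=> D' s' k [].
move=> D' x s2 xD' _ v14 [G2 v13' F2].
have Qx a b : (a \in S) && ((a \in D) || (a == c) && (b \in x |: D')) =
    (a \in S) && ((a \in D) || (a == c) && (b \in D')) || (a == c) && (b == x).
  rewrite in_setU1; case: (eqVneq a c) => [->|] /=; last by rewrite !orbF.
  by rewrite cS /=; case: (b == x); rewrite ?orbT ?orbF.
have st0 : st s2 0 = G := G2.
rewrite /q run_when; case: ifP => /=;
  rewrite v13' v14 dist_idx -/(near r c x) stored_cell G2 -eqn0Ngt; last first.
  move=> cond; split=> //; move: F2; rewrite /found_spec; case: ifP => f2.
    move: cond; rewrite f2 => cond H a b /=.
    rewrite Qx => /orP[]; first exact: H.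
    by move=> /andP[/eqP-> /eqP->] cx; move: cond; rewrite cx /free => /= ->.
  by move=> [a [b [ab *]]]; exists a, b; rewrite /= Qx ab.
case/and3P=> f2 cx xG; set s3 := setn 0 _ 1 s2.
have st3 : st s3 0 = x |: G by rewrite stored_on G2.
have GxK : (x |: G) :\ x = G.
  apply/setP => a; rewrite !in_setD1 in_setU1.
  by case: eqP => // ->; rewrite (negbTE xG).
have v14' : nmem s3 14 0 = idx x by [].
case: ifP => xGI.
  change (Inv2 (x |: D') (setn 0 (nmem s2 14 0) 0 (setn 18 0 (nmem s2 14 0)
    (setn 17 0 (nmem s2 13 0) (setn 9 0 1 s3))))).
  rewrite v13' v14; split=> //.
    by rewrite stored_off -[st _ 0]/(st s3 0) st3.
  rewrite /found_spec /=; exists c, x; rewrite /= Qx !eqxx orbT.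
  by split=> //; rewrite /free xG -st3.
rewrite v14'; split=> //.
  by rewrite stored_off st3.
move: F2; rewrite /found_spec /= f2 => H a b /=.
rewrite Qx => /orP[]; first exact: H.
by move=> /andP[/eqP-> /eqP->] _; rewrite /free xG -st3 xGI.
Qed.

Definition conf s U rho : Prop := [/\ st s 2 = U, st s 0 = rho @: U &
  forall c, c \in U -> nmem s 3 (idx c) = idx (rho c)].

Lemma p_expand_spec s U rho :
  conf s U rho -> nmem s 9 0 = 0%N -> st s 6 \subset st s 5 ->
  [/\ conf (run p_expand s) U rho, nmem (run p_expand s) 9 0 = 0%N,
      st (run p_expand s) 5 = grow I E U rho (st s 5) &
      st (run p_expand s) 6 \subset st (run p_expand s) 5].
Proof.
move=> [sU sG srho] f0 T0S; set S := st s 5 in T0S *; set T0 := st s 6 in T0S.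
rewrite /p_expand run_seq; set p1 := PFor 15 _; set p2 := PFor 13 _.
set N := [set c' | [exists c in S, arc I E U rho c c']].
have ag1 := run_agree P r p1 s.
have : [/\ st (run p1 s) 0 = rho @: U, nmem (run p1 s) 9 0 = 0%N &
    st (run p1 s) 6 = T0 :|: N].
  pose Inv D s' := [/\ st s' 0 = rho @: U, nmem s' 9 0 = 0%N &
    st s' 6 = T0 :|: (N :&: D)].
  suff [? ? H] : Inv setT (run p1 s).
    by split=> //; rewrite setIT in H.
  rewrite /p1; apply: run_for.
  - by split=> //; rewrite setI0 setU0.
  - by move=> D s' k [].
  move=> D c s1 cD ag v15 [G1 f1 T1].
  have U1 : st s1 2 = U by rewrite (stored_agree _ ag).
  have S1 : st s1 5 = S by rewrite (stored_agree _ ag).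
  have e3 : nmem s1 3 = nmem s 3 by case: ag => ag _; rewrite ag.
  rewrite run_when eval_isset eval_cell v15 stored_cell U1; case: ifP => cU.
  2: {
    split=> //; rewrite T1; congr (_ :|: _); apply/setP => a; rewrite !inE.
    case: (eqVneq a c) => [->|] //=; rewrite (negbTE cD) andbT andbF.
    by apply/esym/existsP => -[b]; rewrite /arc cU andbF.
  }
  rewrite !run_seq run_off run_on run_when run_seq run_on run_off.
  rewrite -[neval X s1 _]/(nmem s1 3 (nmem s1 15 0)) v15 e3 srho //.
  set s2 := setn 0 _ 0 s1; set s3 := run p_find s2.
  have st2 : st s2 0 = rho @: U :\ rho c by rewrite stored_off G1.
  have [st3 F3] := p_find_spec (f1 : nmem s2 9 0 = 0%N).
  have ag3 : agree (nwrites p_find) (rwrites p_find) s2 s3 by exact: run_agree.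
  have e33 a : a \in [:: 2; 3; 5; 6; 15]%N -> nmem s3 a = nmem s1 a.
    case: ag3 => h _; rewrite !inE.
    by case/or4P => [||| /orP[]] /eqP->; rewrite h.
  rewrite -[neval X s3 _]/(nmem s3 3 (nmem s3 15 0)) !e33 // v15 e3 srho //.
  set s4 := setn 0 _ 1 s3.
  have st4 : st s4 0 = rho @: U.
    by rewrite stored_on -/s3 st3 st2 setD1K // imset_f.
  have T4 : st s4 6 = T0 :|: N :&: D.
    by rewrite -T1; apply/setP => a; rewrite !inE -[nmem s4 6]/(nmem s3 6) e33.
  have v154 : nmem s4 15 0 = idx c by rewrite -[nmem s4 15]/(nmem s3 15) e33.
  rewrite -[beval _ _ _ _]/(0 < nmem s3 9 0)%N lt0n eval_cell.
  have cND : N :&: (c |: D) = if c \in N then c |: (N :&: D) else N :&: D.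
    apply/setP => a; rewrite !in_setI in_setU1; case: (eqVneq a c) => [->|ac].
      by case: ifP => cN; rewrite ?in_setU1 ?eqxx // in_setI cN.
    by case: ifP => cN; rewrite ?in_setU1 ?(negbTE ac) // in_setI.
  move: F3; rewrite /found_spec; case: ifP => f3 /= F3.
    split=> //; first exact/eqP.
    rewrite T4 cND; case: ifP => //; rewrite inE => /existsP[a /andP[aS]].
    move=> /andP[_ /existsP[x /andP[ax fx]]].
    have := F3 a x; rewrite -[st s2 5]/(st s1 5) S1 st2 => /(_ aS ax).
    by rewrite fx.
  case: F3 => a [x [aS ax fx _]].
  change (Inv (c |: D) (setn 9 0 0 (setn 6 (nmem s4 15 0) 1 s4))).
  rewrite v154; split=> //.
  rewrite -[st _ 6]/(st (setn 6 (idx c) 1 s4) 6) stored_on T4 cND.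
  have -> : c \in N.
    rewrite inE; apply/existsP; exists a; rewrite -S1 aS /arc cU.
    by apply/existsP; exists x; rewrite ax -st2.
  by rewrite setUCA.
set s1 := run p1 s in ag1 * => -[G1 f1 T1].
have S1 : st s1 5 = S by rewrite (stored_agree _ ag1).
have ag2 := run_agree P r p2 s1.
have T2 : st (run p2 s1) 6 = st s1 6 by rewrite (stored_agree _ ag2).
have S2 : st (run p2 s1) 5 = S :|: st s1 6.
  pose Inv D s' := st s' 5 = S :|: (st s1 6 :&: D).
  suff H : Inv setT (run p2 s1) by rewrite /Inv setIT in H.
  apply: run_for.
  - by rewrite /Inv setI0 setU0.
  - by [].
  move=> D c s2 cD ag v13 I2.
  have T2' : st s2 6 = st s1 6 by rewrite (stored_agree _ ag).
  rewrite run_when eval_isset eval_cell v13 stored_cell T2' /Inv.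
  case: ifP => cT.
    have -> : st s1 6 :&: (c |: D) = c |: (st s1 6 :&: D).
      by rewrite setIUr (setIidPr (_ : [set c] \subset _)) // sub1set.
    by rewrite run_on eval_cell v13 stored_on I2 setUCA.
  rewrite I2 setIUr; congr (_ :|: _).
  suff -> : st s1 6 :&: [set c] = set0 by rewrite set0U.
  by apply/eqP; rewrite setI_eq0 disjoint_sym disjoints1 cT.
have NS : T0 :|: N :|: S = S :|: N.
  by rewrite setUAC (setUidPr T0S).
split.
- split.
  + by rewrite (stored_agree _ ag2) // (stored_agree _ ag1).
  + by rewrite (stored_agree _ ag2).
  + by case: ag2 => -> // _; case: ag1 => ->.
- by case: ag2 => -> // _.
- by rewrite S2 T1 setUC NS.
- by rewrite S2 T2 subsetUr.
Qed.

Lemma p_swap_spec s U rho c x :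
  conf s U rho -> {in U &, injective rho} ->
  nmem s 17 0 = idx c -> nmem s 18 0 = idx x ->
  conf (run p_swap s) (c |: U) (reassign rho c x).
Proof.
move=> [sU sG srho] inj v17 v18.
rewrite /p_swap run_seq run_when run_off.
rewrite eval_isset eval_cell v17 stored_cell sU.
set s1 := if _ then _ else _.
have [G1 m1] : st s1 0 = (if c \in U then rho @: U :\ rho c else rho @: U) /\
    forall a, a != 0%N -> nmem s1 a = nmem s a.
  rewrite /s1; case: ifP => cU //.
  rewrite -[neval _ _ _]/(nmem s 3 (nmem s 17 0)) v17 srho // stored_off sG.
  by split=> // a a0; apply/funext => j; rewrite nmem_setn (negbTE a0).
change (conf (setn 3 (nmem s1 17 0) (nmem s1 18 0) (setn 2 (nmem s1 17 0) 1
  (setn 0 (nmem s1 18 0) 1 s1))) (c |: U) (reassign rho c x)).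
rewrite !m1 // v17 v18; set s2 := setn 2 _ 1 _.
split.
- rewrite -[st _ 2]/(st s2 2) stored_on -[st _ 2]/(st s1 2).
  by congr (_ :|: _); rewrite -sU; apply/setP => a; rewrite !inE m1.
- rewrite -[st _ 0]/(st (setn 0 (idx x) 1 s1) 0) stored_on G1.
  by rewrite imset_reassign.
- move=> a; rewrite nmem_setn eqxx idx_eq /= in_setU1 /reassign.
  case: (eqVneq a c) => //= _ aU.
  by rewrite -[upd _ _ _ _ _ _]/(nmem s1 3 (idx a)) m1 // srho.
Qed.

Lemma conf_agree nw rw s s' U rho :
  agree nw rw s s' -> {in nw, forall a, a \notin [:: 0; 2; 3]%N} ->
  conf s U rho -> conf s' U rho.
Proof.
move=> ag h [e1 e2 e3].
have nin a : a \in [:: 0; 2; 3]%N -> a \notin nw.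
  by move=> a3; apply/negP => /h; rewrite a3.
split; rewrite ?(stored_agree _ ag) ?nin //.
by case: ag => ag _; rewrite ag ?nin.
Qed.

Lemma p_search_spec s U rho u :
  conf s U rho -> {in U &, injective rho} -> nmem s 7 0 = idx u ->
  let s' := run p_search s in
  (conf s' U rho /\
   forall c, c \in iter #|X|.-1 (grow I E U rho) [set u] -> ~~ sink I E U rho c)
  \/ exists k c x, [/\ c \in iter k (grow I E U rho) [set u],
       forall j c', (j < k)%N -> c' \in iter j (grow I E U rho) [set u] ->
         ~~ sink I E U rho c', E c x, free I (rho @: U) x &
       conf s' (c |: U) (reassign rho c x)].
Proof.
move=> cs inj v7; set A := fun k => iter k (grow I E U rho) [set u].
rewrite /p_search; set p1 := PFor 13 _; set p2 := PFor 12 _.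
set p3 := when _ p_swap; rewrite !run_seq run_on run_off.
have [cs1 s15 s16 v71] : [/\ conf (run p1 s) U rho, st (run p1 s) 5 = set0,
    st (run p1 s) 6 = set0 & nmem (run p1 s) 7 0 = idx u].
  have ag := run_agree P r p1 s.
  have [h5 h6] : [disjoint st (run p1 s) 5 & setT] /\
      [disjoint st (run p1 s) 6 & setT].
    pose Inv D s' := [disjoint st s' 5 & D] /\ [disjoint st s' 6 & D].
    apply: (run_for (Inv := Inv)).
    - by rewrite /Inv !(disjoint_sym _ (mem set0)) -!setI_eq0 !set0I.
    - by [].
    move=> D x s1 xD _ v13 [d5 d6].
    change (Inv (x |: D)
      (setn 6 (nmem s1 13 0) 0 (setn 5 (nmem s1 13 0) 0 s1))).
    rewrite v13; split.
      rewrite -[st _ 5]/(st (setn 5 (idx x) 0 s1) 5) stored_off.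
      apply: disjointsU1r; first by rewrite !inE eqxx.
      by apply: disjointWl d5; exact: subsetDl.
    rewrite stored_off -[st _ 6]/(st s1 6).
    apply: disjointsU1r; first by rewrite !inE eqxx.
    by apply: disjointWl d6; exact: subsetDl.
  split.
  - by apply: conf_agree ag _ cs => a; rewrite !inE => /or3P[]/eqP->.
  - by move: h5; rewrite -setI_eq0 setIT => /eqP.
  - by move: h6; rewrite -setI_eq0 setIT => /eqP.
  - by case: ag => -> .
set s1 := run p1 s in cs1 s15 s16 v71 *.
rewrite eval_cell v71; set s2 := setn 9 _ _ _.
have cs2 : conf s2 U rho by [].
have G2 : st s2 0 = rho @: U by case: cs2.
have S2 : st s2 5 = A 0%N.
  by rewrite -[st s2 5]/(st (setn 5 (idx u) 1 s1) 5) stored_on s15 setU0.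
have T2 : st s2 6 = set0 by [].
pose Inv D s' := conf s' U rho /\
  if nmem s' 9 0 == 0%N then
    [/\ st s' 5 = A #|D|, st s' 6 \subset st s' 5 &
      forall j c, (j < #|D|)%N -> c \in A j -> ~~ sink I E U rho c]
  else exists k c x, [/\ c \in A k,
    forall j c', (j < k)%N -> c' \in A j -> ~~ sink I E U rho c',
    E c x, free I (rho @: U) x & nmem s' 17 0 = idx c /\ nmem s' 18 0 = idx x].
have [cs3 F3] : Inv setT (run p2 s2).
  apply: run_for.
  - by split=> //=; rewrite cards0 S2 T2 sub0set.
  - by move=> D s' k [].
  move=> D x s3 xD ag v12 [cs3].
  rewrite run_unless -[beval _ _ _ _]/(0 < nmem s3 9 0)%N lt0n if_neg run_seq.
  case: eqP => f3; last by rewrite /Inv; case: eqP.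
  move=> [S3 T3 N3].
  have [G4 F4] := p_find_spec f3.
  have ag4 := run_agree P r p_find s3.
  set s4 := run p_find s3 in G4 F4 ag4 *.
  have G3 : st s3 0 = rho @: U by case: cs3.
  have cs4 : conf s4 U rho.
    split; [|by rewrite G4|]; case: cs3 => U3 _ R3.
      by rewrite (stored_agree _ ag4).
    by case: ag4 => -> // _.
  rewrite run_unless -[beval _ _ _ _]/(0 < nmem s4 9 0)%N lt0n if_neg.
  move: F4; rewrite /found_spec G3 S3; case: eqP => f4 F4.
    have N4 c : c \in A #|D| -> ~~ sink I E U rho c.
      move=> cA; apply/existsPn => y; rewrite negb_and.
      case: (boolP (E c y)) => //= cy; exact: F4 cA cy.
    have S4 : st s4 5 = A #|D| by rewrite (stored_agree _ ag4).
    have T4 : st s4 6 \subset st s4 5 by rewrite !(stored_agree _ ag4) ?T3.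
    have [cs5 f5 S5 T5] := p_expand_spec cs4 f4 T4.
    split=> //; rewrite f5 eqxx cardsU1 xD add1n; split=> //.
      by rewrite S5 S4.
    move=> j c; rewrite ltnS leq_eqVlt => /orP[/eqP->|]; first exact: N4.
    exact: N3.
  case: F4 => c [y [cA cy fy vv]]; split=> //; case: eqP => // _.
  by exists #|D|, c, y.
set s3 := run p2 s2 in cs3 F3 *.
rewrite /p3 run_when -[beval _ _ _ _]/(0 < nmem s3 9 0)%N lt0n if_neg.
case: eqP F3 => f3.
  move=> [S3 _ N3]; left; split=> // c; apply: N3.
  rewrite cardsT; case: (posnP #|X|) => [|X0]; last by rewrite prednK.
  by move=> /card0_eq/(_ u).
move=> [k [c [x [cA N3 cx fx [v17 v18]]]]]; right; exists k, c, x; split=> //.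
exact: p_swap_spec.
Qed.

Lemma p_augment_spec s U rho u :
  conf s U rho -> matching I E U rho -> u \notin U -> nmem s 7 0 = idx u ->
  exists U' rho', [/\ conf (run p_augment s) U' rho', matching I E U' rho' &
    U' = u |: U \/ U' = U /\ ~ matchable I E (u |: U)].
Proof.
move=> cs ms uU v7.
pose path rho' m := exists k, (k + m < #|X|)%N /\
  exists2 c, c \in iter k (grow I E U rho') [set u] & sink I E U rho' c.
pose Inv D s' := exists U' rho', [/\ conf s' U' rho', matching I E U' rho' &
  U' = u |: U \/ U' = U /\ (~ matchable I E (u |: U) \/ path rho' #|D|)].
suff [U' [rho' [cs' ms' H]]] : Inv setT (run p_augment s).
  exists U', rho'; split=> //.
  case: H => [|[e [nm|[k [+ _]]]]]; try by [left|right].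
  by rewrite cardsT addnC ltnNge leq_addr.
apply: run_for.
- exists U, rho; split=> //; right; split=> //.
  case: (pselect (path rho 0%N)) => [|np]; [by rewrite cards0; right|left].
  apply: no_sink_unmatchable ms uU _ => // c cA; apply/negP => sc; apply: np.
  exists #|X|.-1; split; last by exists c.
  rewrite addn0; case: (posnP #|X|) => [/card0_eq/(_ u)//|X0].
  by rewrite prednK.
- by [].
move=> D x s1 xD ag v11 [U1 [rho1 [cs1 ms1 H]]].
have v71 : nmem s1 7 0 = idx u by case: ag => -> .
have U1E : st s1 2 = U1 by case: cs1.
rewrite run_unless eval_isset eval_cell v71 stored_cell U1E.
case: H => [eU|[eU H]].
  rewrite eU setU11; exists U1, rho1; split=> //; by left.
rewrite eU (negbTE uU); rewrite {}eU in cs1 ms1 U1E.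
have [inj1 _ _] := ms1.
have [[cs2 ns]|[k [c [y [cA N2 cy fy cs2]]]]] := p_search_spec cs1 inj1 v71.
  exists U, rho1; split; [exact: cs2|exact: ms1|right; split=> //; left].
  exact: no_sink_unmatchable ms1 uU ns.
exists (c |: U), (reassign rho1 c y); split=> //.
  exact: matching_reassign.
have sc : sink I E U rho1 c by apply/existsP; exists y; rewrite cy.
case: k => [|k] in cA N2.
  by left; move: cA; rewrite /= inE => /eqP->.
have cnA : c \notin iter k (grow I E U rho1) [set u].
  by apply: contraL sc; exact: N2.
have cU : c \in U.
  by move: cA; rewrite /= inE (negbTE cnA) inE => /existsP[c1 /and3P[]].
have cUE : c |: U = U by apply/setUidPr; rewrite sub1set.
right; rewrite cUE; split=> //; right.
have kD : (k.+1 + #|D| < #|X|)%N.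
  case: H => [nm|[j [jX [c' c'A sc']]]].
    have uk : u \in [set u] by rewrite set11.
    have dis : [disjoint [set u] & U] by rewrite disjoints1.
    have [v] := sink_matchable indep_sub indep_aug ms1 dis cA sc.
    by rewrite inE => /eqP->.
  apply: leq_ltn_trans jX; rewrite leq_add2r leqNgt; apply/negP => jk.
  by move: sc'; apply/negP; exact: N2 c'A.
exists k; split; first by rewrite cardsU1 xD add1n -addSnnS.
by apply: (reassign_reach indep_sub indep_aug ms1) => // c'; exact: N2.
Qed.

Lemma p_gain_spec s u :
  nmem s 13 0 = idx u -> rmem (run p_gain s) 0 0 = gain P r (st s 4) u.
Proof.
move=> v13; rewrite /p_gain run_seq; set s1 := run (PR _ _ _) s.
set L := PFor 16 _.
pose Inv D s' := rmem s' 0 0 =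
  Defs.total (weight P) ((fball u r :\: st s 4) :&: D).
suff H : Inv setT (run L s1) by rewrite H setIT.
apply: run_for.
- by rewrite /Inv setI0 /Defs.total big_set0 /s1 /= /upd.
- by [].
move=> D x s2 xD ag v16 I2.
have v13' : nmem s2 13 0 = idx u by case: ag => -> .
have T2 : st s2 4 = st s 4 by rewrite (stored_agree _ ag).
rewrite run_when /= v16 v13' dist_idx stored_cell T2 /Inv.
have [cond|cond] := ifP.
  rewrite /= /upd /= weight_idx I2.
  rewrite (_ : _ :&: (x |: D) = x |: ((fball u r :\: st s 4) :&: D)).
    rewrite [in RHS]/Defs.total big_setU1 ?in_setI ?(negbTE xD) ?andbF //=.
    by rewrite addrC.
  rewrite setIUr (setIidPr (_ : [set x] \subset _)) // sub1set in_setD.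
  rewrite [x \in fball _ _]inE.
  by rewrite andbC.
rewrite I2; congr (Defs.total _ _); rewrite setIUr.
rewrite (_ : _ :&: [set x] = set0) ?set0U //; apply/eqP.
rewrite setI_eq0 disjoint_sym disjoints1 in_setD.
by rewrite [x \in fball _ _]inE andbC cond.
Qed.

Lemma p_pick_spec s :
  if nmem (run p_pick s) 8 0 == 0%N then forall v, v \in st s 1 else
  exists2 u, u \notin st s 1 & nmem (run p_pick s) 7 0 = idx u /\
    forall v, v \notin st s 1 -> gain P r (st s 4) v <= gain P r (st s 4) u.
Proof.
rewrite /p_pick run_seq run_off; set s1 := setn 8 _ _ s.
set L := PFor 13 _.
pose Inv D s' := if nmem s' 8 0 == 0%N then forall v, v \in D -> v \in st s 1
  else exists2 u, u \notin st s 1 & [/\ nmem s' 7 0 = idx u,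
    rmem s' 1 0 = gain P r (st s 4) u & forall v, v \in D -> v \notin st s 1 ->
      gain P r (st s 4) v <= gain P r (st s 4) u].
suff : Inv setT (run L s1).
  rewrite /Inv; case: ifP => _; first by move=> H v; apply: H; rewrite inE.
  move=> [u ud [? _ H]]; exists u => //; split=> // v; apply: H; by rewrite inE.
apply: run_for.
- by rewrite /Inv /= => v; rewrite inE.
- by [].
move=> D x s2 xD ag v13 I2.
have D2 : st s2 1 = st s 1 by rewrite (stored_agree _ ag).
have C2 : st s2 4 = st s 4 by rewrite (stored_agree _ ag).
rewrite run_unless eval_isset eval_cell v13 stored_cell D2.
case: ifP => xd.
  move: I2; rewrite /Inv; case: ifP => _.
    by move=> H v; rewrite !in_setU1 => /orP[/eqP->//|]; exact: H.
  move=> [u ud [? ? H]]; exists u => //; split=> // v.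
  by rewrite in_setU1 => /orP[/eqP->|]; [rewrite xd|exact: H].
rewrite run_seq; have g3 := p_gain_spec v13; rewrite C2 in g3.
have [n3 r3] := run_agree P r p_gain s2.
set s3 := run p_gain s2 in g3 n3 r3 *.
rewrite run_unless -[beval _ _ _ _]/((0 < nmem s3 8 0)%N &&
  ~~ (rmem s3 1 0 <= rmem s3 0 0)) g3 n3 // r3 // lt0n.
set s4 := run _ s3.
have s4E : nmem s4 8 0 = 1%N /\ nmem s4 7 0 = idx x /\
    rmem s4 1 0 = gain P r (st s 4) x.
  split=> //; split; first by rewrite -v13 -n3.
  by rewrite -g3.
clearbody s4 s3; move: I2 s4E; rewrite {1}/Inv.
case: eqP => f2 /= I2 [e8 [e7 e1]].
  rewrite /Inv e8 /=; exists x; first by rewrite xd.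
  split=> // v; rewrite in_setU1 => /orP[/eqP->//|/I2->//].
case: I2 => u ud [h7 h1 H]; rewrite h1; case: ifP => [lt|/negbFE le].
  rewrite /Inv n3 //; case: eqP => // _; exists u => //.
  split; [by rewrite n3|by rewrite r3|move=> v].
  rewrite in_setU1 => /orP[/eqP-> _|/H//].
  by apply: ltW; rewrite ltNge.
rewrite /Inv e8 /=; exists x; first by rewrite xd.
split=> // v; rewrite in_setU1 => /orP[/eqP->//|vD vd].
exact: le_trans (H v vD vd) le.
Qed.

Lemma p_cover_spec s u : nmem s 7 0 = idx u ->
  st (run p_cover s) 4 = fball u (r + r + r) :|: st s 4.
Proof.
move=> v7.
pose Inv D s' := st s' 4 = (fball u (r + r + r) :&: D) :|: st s 4.
suff H : Inv setT (run p_cover s) by rewrite H setIT.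
apply: run_for.
- by rewrite /Inv setI0 set0U.
- by [].
move=> D x s2 xD ag v16 I2.
have v7' : nmem s2 7 0 = idx u by case: ag => -> .
rewrite run_when /= v16 v7' dist_idx /Inv.
have [cond|cond] := ifP.
  change (st (setn 4 (idx x) 1 s2) 4 =
    fball u (r + r + r) :&: (x |: D) :|: st s 4).
  rewrite stored_on I2 setIUr (setIidPr (_ : [set x] \subset _)) ?setUA //.
  by rewrite sub1set inE.
rewrite I2; congr (_ :|: _); rewrite setIUr.
rewrite (_ : _ :&: [set x] = set0) ?set0U //; apply/eqP.
by rewrite setI_eq0 disjoint_sym disjoints1 inE cond.
Qed.

Lemma p_main_spec s :
  nmem s = (fun _ _ => 0%N) ->
  exists U rho, [/\ conf (run p_main s) U rho, matching I E U rho &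
    greedy_inv P r setT U].
Proof.
move=> s0.
have st0 a : st s a = set0 by apply/setP => x; rewrite !inE s0.
pose Inv D s' := exists U rho, [/\ conf s' U rho, matching I E U rho,
  st s' 4 = cover r U, greedy_inv P r (st s' 1) U &
  (#|D| <= #|st s' 1|)%N].
suff [U [rho [cs ms _ gi le]]] : Inv setT (run p_main s).
  exists U, rho; split=> //.
  suff <- : st (run p_main s) 1 = setT by [].
  by apply/eqP; rewrite eqEcard subsetT.
apply: run_for.
- exists set0, id; split.
  + by split; rewrite ?st0 ?imset0 // => c; rewrite inE.
  + split; [by move=> c; rewrite inE|by move=> c; rewrite inE|].
    by rewrite imset0; exact: matroid0 (indep_matroid P).
  + by rewrite st0 /cover /fballs big_set0.
  + by rewrite st0; exact: greedy_inv0.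
  + by rewrite cards0.
- by move=> D s' k [U [rho [cs ms cov gi le]]]; exists U, rho.
move=> D x s1 xD _ v10 [U [rho [cs ms cov gi le]]].
rewrite run_seq; have := p_pick_spec s1; have ag2 := run_agree P r p_pick s1.
set s2 := run p_pick s1 in ag2 *.
have cs2 : conf s2 U rho.
  apply: conf_agree ag2 _ cs => a; rewrite !inE.
  by do ![case/orP]; move=> /eqP->.
have d2 : st s2 1 = st s1 1 by rewrite (stored_agree _ ag2).
have c2 : st s2 4 = st s1 4 by rewrite (stored_agree _ ag2).
rewrite run_when -[beval _ _ _ _]/(0 < nmem s2 8 0)%N lt0n if_neg.
case: eqP => f8 pick.
  exists U, rho; rewrite d2 c2; split=> //.
  have -> : st s1 1 = setT by apply/setP => v; rewrite pick in_setT.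
  by rewrite cardsT max_card.
case: pick => u ud [v7 best].
rewrite !run_seq run_on eval_cell v7; set s3 := setn 1 _ 1 s2.
have cs3 : conf s3 U rho by [].
have d3 : st s3 1 = u |: st s1 1 by rewrite stored_on d2.
have uU : u \notin U by apply: contra ud; case: gi => /subsetP + _; exact.
have [U' [rho' [cs4 ms4 H]]] := p_augment_spec cs3 ms uU v7.
have ag4 := run_agree P r p_augment s3.
set s4 := run p_augment s3 in cs4 ag4 *.
have d4 : st s4 1 = u |: st s1 1 by rewrite (stored_agree _ ag4).
have c4 : st s4 4 = cover r U by rewrite (stored_agree _ ag4) // -cov -c2.
have v74 : nmem s4 7 0 = idx u by case: ag4 => -> .
have cD : (#|x |: D| <= #|u |: st s1 1|)%N.
  by rewrite !cardsU1 xD ud leq_add2l.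
have U4 : st s4 2 = U' by case: cs4.
rewrite run_when eval_isset eval_cell v74 stored_cell U4.
case: H => [eU|[eU nm]].
  rewrite {}eU in cs4 ms4 U4 *; rewrite setU11.
  have ag5 := run_agree P r p_cover s4.
  have c5 := p_cover_spec v74.
  set s5 := run p_cover s4 in ag5 c5 *.
  exists (u |: U), rho'; split=> //.
  - by apply: conf_agree ag5 _ cs4 => a; rewrite !inE => /orP[]/eqP->.
  - by rewrite c5 c4 coverU1.
  - rewrite (stored_agree _ ag5) // d4; apply: greedy_inv_add => //.
      by exists rho'.
    by move=> v vd; rewrite -cov; exact: best.
  - by rewrite (stored_agree _ ag5) // d4.
rewrite {}eU in cs4 ms4 U4 *; rewrite (negbTE uU).
exists U, rho'; split=> //; first by rewrite d4; exact: greedy_inv_skip.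
by rewrite d4.
Qed.
End Correct.

Theorem theorem2 :
  exists (A : cmd) (c k : nat),
    forall (R : realType) (X : finMetricType R) (P : rmc_instance X) (r : R),
    0 <= r ->
    exists (t : nat) (s : state R),
      [/\ exec P r A (init_state R) t s,
          (t <= c * #|X|.+1 ^ k)%N &
          (exists F : {set X}, rmc_solution P r F) ->
          rmc_solution P (5 * r) (output X s)].
Proof.
have [c [k cost_le]] := cost_poly p_main.
exists (compile p_main), c, k => R X P r r0.
have [t e le] := run_exec P r (init_state R) wf_p_main.
exists t, (run P r p_main (init_state R)); split=> //.
  exact: leq_trans le (cost_le _).
have [U [rho [[_ sG _] ms gi]]] :=
  p_main_spec P r0 (erefl : nmem (init_state R) = _).
by rewrite /output sG; exact: greedy_inv_final.
Qed.
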